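(* Given $d\ge 2$, $\varepsilon>0$, and a constant $c>0$, there exists $\gamma=\Omega_c\left(\dfrac{1}{d\log d}\cdot\dfrac{\varepsilon^2}{\log^2(1/\varepsilon)}\right)$ (the implied constant depending only on $c$) such that the following holds for any field $\mathbb{F}$ and any sequence of matrices $M_1,\dots,M_k$ with $M_i\in\mathbb{F}^{d_i\times d_i}$ and $cd\le d_i\le d$. Let $M=\bigotimes_{i=1}^k M_i$ and $n=\prod_{i=1}^k d_i$. If $n\ge d^{1/\gamma}$, then $R_{\mathbb{F}}(M,n^{1-\gamma})\le n^{1+\varepsilon}$.
   Context: For a field $\mathbb{F}$, a matrix $A\in\mathbb{F}^{n\times m}$ and a target rank $r\ge 0$, the rigidity $R_{\mathbb{F}}(A,r)$ is the minimum number of non-zero entries of a matrix $Z\in\mathbb{F}^{n\times m}$ such that $\operatorname{rank}(A-Z)\le r$. $\bigotimes$ denotes the Kronecker product.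
   Formalization: The factor log(1/ε) is read as max(1, log(1/ε)): as written the bound is undefined at ε = 1 and, as ε → 1 from below, would force γ > 1 (target rank 0), which all-ones matrices violate; for ε ≤ 1/e the two bounds coincide. *)

(* Defs.v *)
From mathcomp Require Export all_boot all_order all_algebra.
From mathcomp Require Export boolp reals interval_inference exp.
From mathcomp Require Export mxtens.

Set Implicit Arguments.
Unset Strict Implicit.
Unset Printing Implicit Defensive.

Import Order.TTheory GRing.Theory Num.Theory.
Local Open Scope ring_scope.

Definition nnz (F : fieldType) (n m : nat) (Z : 'M[F]_(n, m)) : nat :=
  #|[set ij : 'I_n * 'I_m | Z ij.1 ij.2 != 0]|.

(* The target rank is a nonnegative real because it is applied to powers such
   as n `^ (1 - gamma), which need not be integers. *)
Definition rigidity_attained (F : fieldType) (R : realType) (n m : nat)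
    (A : 'M[F]_(n, m)) (r : {nonneg R}) : pred nat :=
  fun s => `[< exists2 Z : 'M[F]_(n, m),
                 (\rank (A - Z))%:R <= r%:num & nnz Z = s >].

Lemma rigidity_attained_ex (F : fieldType) (R : realType) (n m : nat)
    (A : 'M[F]_(n, m)) (r : {nonneg R}) : exists s, rigidity_attained A r s.
Proof.
by exists (nnz A); apply/asboolP; exists A => //; rewrite subrr mxrank0 mulr0n ge0.
Qed.

Definition rigidity (F : fieldType) (R : realType) (n m : nat)
    (A : 'M[F]_(n, m)) (r : {nonneg R}) : nat :=
  ex_minn (rigidity_attained_ex A r).

(* M_0 *t (M_1 *t ( ... *t (M_(k-1) *t 1%:M))); the casts only rewrite the
   dimension into the form \prod_(i < k) d i. *)
Fixpoint bigtensmx (F : fieldType) (k : nat) :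
    forall d : 'I_k -> nat, (forall i, 'M[F]_(d i)) ->
      'M[F]_(\prod_(i < k) d i)%N :=
  match k with
  | 0 => fun d _ =>
      let e := esym (@big_ord0 _ 1%N muln xpredT d) in castmx (e, e) (1%:M : 'M[F]_1)
  | k'.+1 => fun d M =>
      let e := esym (@big_ord_recl _ 1%N muln k' d) in
      castmx (e, e)
        (M ord0 *t @bigtensmx F k' (fun i => d (lift ord0 i))
                                   (fun i => M (lift ord0 i)))
  end.

(* For the factor log (1 / eps) inside an asymptotic bound: it equals
   ln (1 / eps) as soon as eps <= 1 / e. Unguarded, eps ^+ 2 / ln (1 / eps) ^+ 2
   blows up as eps -> 1 from below; a gamma of that size exceeds 1, so the
   target rank is 0, and all-ones matrices violate the rigidity bound. *)
Definition guarded_ln (R : realType) (x : R) : R := Num.max 1 (ln x).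

(* Main.v *)
Require Import Defs.
From mathcomp Require Import fingroup perm zify ring lra sequences.

(** By the LUP decomposition every [m x m] matrix with [m <= d] is a product of
    [2 d + 1] matrices, each either a permutation matrix or an identity matrix
    with one row [p] replaced. Hence the Kronecker product [M] is a product of
    [2 d + 1] Kronecker products of such elementary factors. If
    [B = B_1 *t ... *t B_k] is one of these, a nonzero entry [(I, J)] of [B]
    satisfies [I_t = J_t] or [I_t = p_t] for every [t], so the number of [t]
    with [I_t <> J_t] is [w I - w J], where [w I] counts the [t] with
    [I_t = p_t]. By a Chernoff bound, [w] is within [s] of its mean outside an
    exponentially small proportion of indices; deleting the exceptional rows and
    columns changes [B] by a matrix of small rank, and leaves rows whose nonzero
    entries [J] differ from [I] in at most [2 s] coordinates, hence are few.
    Multiplying out the factors, the products of the sparse parts stay sparse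
    and the ranks of the corrections add up. Each factor may only contribute
    [n `^ (eps / (2 d + 1))] to the row sparsity, which forces
    [s ~ eps ln n / (d ln d ln (1 / eps))]; since [w] has variance about
    [ln n / (d ln d)], the tails are about
    [exp (- s ^ 2 d ln d / ln n) = n `^ (- gamma)]. *)

Set Implicit Arguments.
Unset Strict Implicit.
Unset Printing Implicit Defensive.

Import Order.TTheory GRing.Theory Num.Theory.
Local Open Scope ring_scope.

(** * Factoring a matrix into elementary matrices *)

(* Covers both a permutation matrix ([sp.2] is then irrelevant) and an identity
   matrix whose row [sp.2] is replaced ([sp.1] is then the identity). *)
Definition elementary (F : fieldType) (m : nat) (A : 'M[F]_m)
    (sp : 'S_m * 'I_m) : Prop :=
  forall i j, A i j != 0 -> j = sp.1 i \/ sp.1 i = sp.2.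

Definition elementary_product (F : fieldType) (m r : nat) (A : 'M[F]_m) :=
  exists E : nat -> 'M[F]_m,
    (forall s, exists sp, elementary (E s) sp) /\ A = \prod_(s < r) E s.

Lemma elementary_productM (F : fieldType) (m r1 r2 : nat) (A B : 'M[F]_m) :
  elementary_product r1 A -> elementary_product r2 B ->
  elementary_product (r1 + r2) (A * B).
Proof.
move=> [E1 [e1 ->]] [E2 [e2 ->]].
exists (fun s => if (s < r1)%N then E1 s else E2 (s - r1)%N); split.
  by move=> s; case: ifP.
rewrite big_split_ord /=; congr (_ * _); apply: eq_bigr => s _.
  by rewrite /= ltn_ord.
by rewrite /= ltnNge leq_addr /= addKn.
Qed.

Lemma elementary_product_perm (F : fieldType) (m : nat) (s : 'S_m.+1) :
  elementary_product 1 (perm_mx s : 'M[F]_m.+1).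
Proof.
exists (fun=> perm_mx s); split; last by rewrite big_ord1.
move=> _; exists (s, ord0) => i j; rewrite !mxE /=.
by case: (eqVneq (s i) j) => [->|_]; [left|rewrite eqxx].
Qed.

(* [rho] is the order in which the rows of [A] are inserted: row [i] only
   involves indices [j] with [rho j <= rho i], on which all later factors act as
   the identity. *)
Lemma elementary_product_trig (F : fieldType) (m r : nat) (A : 'M[F]_m.+1)
    (rho : 'I_m.+1 -> nat) : injective rho -> (forall i, rho i < r)%N ->
  (forall i j, A i j != 0 -> (rho j <= rho i)%N) -> elementary_product r A.
Proof.
move=> rho_inj rho_lt trigA.
pose E s : 'M[F]_m.+1 :=
  \matrix_(i, j) if rho i == s then A i j else (i == j)%:R.
exists E; split=> [s|].
  (* If no row has order [s], then [E s] is the identity and the default index is harmless. *)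
  exists (1%g, odflt ord0 [pick i | rho i == s]) => i j.
  rewrite !mxE perm1; case: (eqVneq (rho i) s) => [rho_i _|_].
    right; case: pickP => /= [i' /eqP rho_i'|/(_ i)]; last by rewrite rho_i eqxx.
    by apply: rho_inj; rewrite rho_i.
  by case: (eqVneq i j) => [->|]; [left|rewrite eqxx].
have prodE q : \prod_(s < q) E s =
    \matrix_(i, j) if (rho i < q)%N then A i j else (i == j)%:R.
  elim: q => [|q IHq].
    by rewrite big_ord0; apply/matrixP => i j; rewrite !mxE.
  rewrite big_ord_recr /= {}IHq -mulmxE; apply/matrixP => i j; rewrite !mxE.
  have [lt_iq|le_qi] := ltnP (rho i) q.
    rewrite ltnW // (bigD1 j) //= big1 => [|l lj]; rewrite !mxE lt_iq.
      have [rho_j|_] := eqVneq (rho j) q; last by rewrite eqxx mulr1 addr0.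
      have [->|/trigA] := eqVneq (A i j) 0; first by rewrite mul0r addr0.
      by rewrite rho_j leqNgt lt_iq.
    have [rho_l|_] := eqVneq (rho l) q; last by rewrite (negPf lj) mulr0.
    have [->|/trigA] := eqVneq (A i l) 0; first by rewrite mul0r.
    by rewrite rho_l leqNgt lt_iq.
  rewrite (bigD1 i) //= big1 => [|l li]; rewrite !mxE ltnNge le_qi /=.
    by rewrite eqxx mul1r addr0 ltnS eqn_leq le_qi andbT.
  by rewrite eq_sym (negPf li) mul0r.
by rewrite prodE; apply/matrixP => i j; rewrite mxE rho_lt.
Qed.

(** Write [A = P^-1 L U]; [L] is built from its top row down, [U] from its bottom row up. Padding
    both to [d] factors with identities gives all sizes [m <= d] the same number of factors. *)
Lemma elementary_product_lup (F : fieldType) (m d : nat) (A : 'M[F]_m) :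
  (0 < m <= d)%N -> elementary_product (1 + (d + d)) A.
Proof.
case: m A => // m A /andP[_ le_md].
have := cormen_lup_correct A; have := cormen_lup_perm A.
have := @cormen_lup_lower _ _ A; have := @cormen_lup_upper _ _ A.
case: (cormen_lup A) => [[P L] U] /= upU lowL /is_perm_mxP[s ->] PA.
have -> : A = perm_mx s^-1%g * (L * U).
  by rewrite -PA mulrA -!mulmxE -perm_mxM mulVg perm_mx1 mul1mx.
apply: elementary_productM; first exact: elementary_product_perm.
apply: elementary_productM.
  apply: (@elementary_product_trig _ _ _ _ (fun i => i)) => [|i|i j].
  - exact: val_inj.
  - exact: leq_trans (ltn_ord i) le_md.
  - apply: contraNT; rewrite -ltnNge => lt_ij.
    by rewrite lowL 1?ltnW // -val_eqE ltn_eqF.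
apply: (@elementary_product_trig _ _ _ _ (fun i => rev_ord i)) => [|i|i j].
- by move=> i j /val_inj /rev_ord_inj.
- exact: leq_trans (ltn_ord (rev_ord i)) le_md.
- apply: contraNT; rewrite -ltnNge /= => lt_ij; rewrite upU //.
  by move: lt_ij (leq_ord i); rewrite !subSS; lia.
Qed.

(** * Kronecker products and their coordinates *)

Lemma bigtensmxM (F : fieldType) (k : nat) (dd : 'I_k -> nat)
    (A B : forall i, 'M[F]_(dd i)) :
  bigtensmx (fun i => A i * B i) = bigtensmx A * bigtensmx B.
Proof.
have castM n n' (e : n = n') (X Y : 'M[F]_n) :
    castmx (e, e) (X *m Y) = castmx (e, e) X * castmx (e, e) Y.
  by case: n' / e.
elim: k => [|k IHk] in dd A B *; first by rewrite /= -castM mulmx1.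
by rewrite /= -castM tensmx_mul IHk.
Qed.

Lemma bigtensmx1 (F : fieldType) (k : nat) (dd : 'I_k -> nat) :
  bigtensmx (fun i => 1 : 'M[F]_(dd i)) = 1.
Proof.
have cast1 n n' (e : n = n') : castmx (e, e) (1%:M : 'M[F]_n) = 1.
  by case: n' / e.
elim: k => [|k IHk] in dd *; first exact: cast1.
rewrite /= IHk; set T := tensmx _ _; suff -> : T = 1%:M by exact: cast1.
rewrite /T; apply/matrixP => i j.
case: (mxtens_indexP i) => i0 i1; case: (mxtens_indexP j) => j0 j1.
rewrite tensmxE !mxE -natrM mulnb -xpair_eqE.
by rewrite -(can_eq (@mxtens_indexK _ _)).
Qed.

Lemma bigtensmx_prod (F : fieldType) (k r : nat) (dd : 'I_k -> nat)
    (E : forall i, nat -> 'M[F]_(dd i)) :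
  bigtensmx (fun i => \prod_(s < r) E i s) =
    \prod_(s < r) bigtensmx (fun i => E i s).
Proof.
elim: r => [|r IHr].
  rewrite big_ord0 -bigtensmx1; congr bigtensmx.
  by apply: functional_extensionality_dep => i; rewrite big_ord0.
rewrite big_ord_recr /= -IHr -bigtensmxM; congr bigtensmx.
by apply: functional_extensionality_dep => i; rewrite big_ord_recr.
Qed.

Definition cons_coord (k : nat) (d : 'I_k.+1 -> nat) (a : 'I_(d ord0))
    (b : forall i, 'I_(d (lift ord0 i))) (i : 'I_k.+1) : 'I_(d i) :=
  match unliftP ord0 i with
  | UnliftSome j e => cast_ord (congr1 d (esym e)) (b j)
  | UnliftNone e => cast_ord (congr1 d (esym e)) a
  end.

Lemma cons_coord0 (k : nat) (d : 'I_k.+1 -> nat) a b :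
  cons_coord (d := d) a b ord0 = a.
Proof.
rewrite /cons_coord; case: unliftP => [j e|e]; last exact: val_inj.
by case/eqP: (neq_lift ord0 j).
Qed.

Lemma cons_coordS (k : nat) (d : 'I_k.+1 -> nat) a b j :
  cons_coord (d := d) a b (lift ord0 j) = b j.
Proof.
rewrite /cons_coord; case: unliftP => [j' e|e].
  by have /lift_inj ej := e; apply: val_inj => /=; rewrite ej.
by case/eqP: (neq_lift ord0 j); exact: esym.
Qed.

(** The mixed-radix digits of an index of [bigtensmx], one for each tensor factor. *)
Fixpoint coord (k : nat) :
    forall d : 'I_k -> nat, 'I_(\prod_(i < k) d i)%N -> forall i, 'I_(d i) :=
  match k with
  | 0 => fun d _ i => False_rect _ (notF (ltn_ord i))
  | k'.+1 => fun d I =>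
      let u := mxtens_unindex (cast_ord (@big_ord_recl _ 1%N muln k' d) I) in
      cons_coord u.1 (@coord k' (fun i => d (lift ord0 i)) u.2)
  end.

Lemma bigtensmxE (F : fieldType) (k : nat) (dd : 'I_k -> nat)
    (A : forall i, 'M[F]_(dd i)) I J :
  bigtensmx A I J = \prod_i A i (coord I i) (coord J i).
Proof.
elim: k => [|k IHk] in dd A I J *.
  by rewrite [RHS]big_ord0 /= castmxE mxE !ord1 eqxx.
rewrite [RHS]big_ord_recl /= castmxE /= !esymK mxE IHk !cons_coord0.
by congr (_ * _); apply: eq_bigr => i _; rewrite !cons_coordS.
Qed.

(** Distributivity, read as independence of the coordinates of a uniform index: exponential moments
    factor. *)
Lemma sum_prod_coord (R : comPzRingType) (k : nat) (d : 'I_k -> nat)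
    (f : forall i, 'I_(d i) -> R) :
  \sum_I \prod_i f i (coord I i) = \prod_i \sum_j f i j.
Proof.
elim: k => [|k IHk] in d f *.
  rewrite [RHS]big_ord0 (eq_bigr (fun=> 1)) => [|I _]; last exact: big_ord0.
  by rewrite sumr_const card_ord big_ord0.
rewrite [RHS]big_ord_recl -IHk mulr_sum.
have e := @big_ord_recl _ 1%N muln k d.
rewrite (reindex (cast_ord (esym e))) /=; last first.
  by apply: onW_bij; exists (cast_ord e); [exact: cast_ordKV|exact: cast_ordK].
apply: eq_bigr => I _; rewrite big_ord_recl /= cons_coord0.
congr (_ * _); first by congr f; exact: val_inj.
apply: eq_bigr => i _; rewrite cons_coordS; congr f.
by congr (@coord k _ _ i); exact: val_inj.
Qed.

(** * Sparse plus low-rank decompositions and rigidity *)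

Lemma mxrank_row_support (F : fieldType) (m n : nat) (A : 'M[F]_(m, n))
    (X : {set 'I_m}) :
  (forall i j, A i j != 0 -> i \in X) -> (\rank A <= #|X|)%N.
Proof.
move=> suppA.
have -> : A = \sum_(i in X) delta_mx i (0 : 'I_1) *m row i A.
  apply/matrixP => i j; rewrite summxE (eq_bigr (fun l => (i == l)%:R * A l j)).
    have [iX|iX] := boolP (i \in X).
      rewrite (bigD1 i) //= eqxx mul1r big1 ?addr0 // => l /andP[_ li].
      by rewrite eq_sym (negPf li) mul0r.
    rewrite big1 => [|l lX].
      by apply/eqP; apply: contraNT iX; exact: suppA.
    by have /negPf-> : i != l; [apply: contraNneq iX => ->|rewrite mul0r].
  by move=> l _; rewrite mxE big_ord1 !mxE andbT.
rewrite -sum1_card.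
apply: (big_ind2 (fun (B : 'M[F]_(m, n)) r => (\rank B <= r)%N)).
- by rewrite mxrank0.
- by move=> B r B' r' hB hB'; apply: leq_trans (mxrank_add _ _) (leq_add hB hB').
- by move=> i _; apply: leq_trans (mxrankM_maxl _ _) _; rewrite mxrank_delta.
Qed.

Lemma mxrank_col_support (F : fieldType) (m n : nat) (A : 'M[F]_(m, n))
    (X : {set 'I_n}) :
  (forall i j, A i j != 0 -> j \in X) -> (\rank A <= #|X|)%N.
Proof.
move=> suppA; rewrite -mxrank_tr; apply: mxrank_row_support => i j.
by rewrite mxE; exact: suppA.
Qed.

Definition row_support (F : fieldType) (n : nat) (A : 'M[F]_n) (i : 'I_n) :
  {set 'I_n} := [set j | A i j != 0].

(** Sparsity is bounded row by row, since such bounds multiply under matrix products; the total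
    count costs one more factor [n]. *)
Definition sparse_plus_low_rank (F : fieldType) (R : realType) (n : nat)
    (q r : R) (A : 'M[F]_n) :=
  exists S : 'M[F]_n,
    (forall i, #|row_support S i|%:R <= q) /\ (\rank (A - S))%:R <= r.

Lemma sparse_plus_low_rank_prod (F : fieldType) (R : realType) (n m : nat)
    (q r : R) (B : nat -> 'M[F]_n) : 0 <= q ->
  (forall s, sparse_plus_low_rank q r (B s)) ->
  sparse_plus_low_rank (q ^+ m) (m%:R * r) (\prod_(s < m) B s).
Proof.
move=> q0 hB; elim: m => [|m [S [hS rS]]].
  exists 1; rewrite big_ord0 subrr mxrank0 mul0r; split=> // i.
  rewrite expr0 (_ : row_support _ _ = [set i]) ?cards1 //.
  apply/setP => j; rewrite !inE mxE (eq_sym j).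
  by case: (i == j); rewrite ?oner_eq0 ?eqxx.
have [T [hT rT]] := hB m; exists (S * T); rewrite big_ord_recr /=; split=> [i|].
  have sub : row_support (S * T) i \subset
      \bigcup_(l in row_support S i) row_support T l.
    apply/subsetP => j; rewrite inE => STij; apply/bigcupP.
    apply/exists_inP; apply: contraNT STij => /exists_inPn noj.
    rewrite -mulmxE mxE big1 // => l _.
    have [->|Sil] := eqVneq (S i l) 0; first by rewrite mul0r.
    have : l \in row_support S i by rewrite inE.
    by move=> /noj; rewrite inE negbK => /eqP->; rewrite mulr0.
  apply: le_trans (_ : (\sum_(l in row_support S i) #|row_support T l|)%:R <= _).
    rewrite ler_nat; apply: leq_trans (subset_leq_card sub) _.
    apply: (big_ind2 (fun (X : {set 'I_n}) c => (#|X| <= c)%N)) => //.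
      by rewrite cards0.
    move=> X c Y c' hX hY.
    exact: leq_trans (leq_card_setU _ _) (leq_add hX hY).
  rewrite natr_sum; apply: le_trans (ler_sum _ (fun l _ => hT l)) _.
  rewrite sumr_const exprSr -[q *+ _]mulr_natl.
  exact: ler_wpM2r (hS i).
set P := \prod_(s < m) _ in rS *.
(* Telescoping: multiplying by [B m] or [S] does not raise the rank of the error. *)
have -> : P * B m - S * T = (P - S) * B m + S * (B m - T).
  by rewrite mulrBl mulrBr addrA subrK.
have -> : m.+1%:R * r = m%:R * r + r by rewrite -natr1 mulrDl mul1r.
apply: le_trans (lerD rS rT).
rewrite -natrD ler_nat; apply: leq_trans (mxrank_add _ _) _.
by apply: leq_add; [exact: mxrankM_maxl|exact: mxrankM_maxr].
Qed.

Lemma nnz_row_support (F : fieldType) (n : nat) (A : 'M[F]_n) :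
  nnz A = (\sum_i #|row_support A i|)%N.
Proof.
rewrite /nnz -sum1_card (eq_bigl (fun ij : 'I_n * 'I_n => A ij.1 ij.2 != 0)).
  rewrite -(pair_big_dep xpredT (fun i j => A i j != 0) (fun _ _ => 1%N)) /=.
  by apply: eq_bigr => i _; rewrite -sum1_card; apply: eq_bigl => j; rewrite inE.
by move=> ij; rewrite inE.
Qed.

Lemma rigidity_le (F : fieldType) (R : realType) (n m : nat)
    (A Z : 'M[F]_(n, m)) (r : {nonneg R}) :
  (\rank (A - Z))%:R <= r%:num -> (rigidity A r <= nnz Z)%N.
Proof.
move=> hr; rewrite /rigidity; case: ex_minnP => s _; apply.
by apply/asboolP; exists Z.
Qed.

Lemma sparse_plus_low_rank_rigidity (F : fieldType) (R : realType) (n : nat)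
    (q : R) (r : {nonneg R}) (A : 'M[F]_n) :
  sparse_plus_low_rank q r%:num A -> (rigidity A r)%:R <= n%:R * q.
Proof.
move=> [S [hS /rigidity_le]]; rewrite -(ler_nat R) => /le_trans; apply.
rewrite nnz_row_support natr_sum; apply: le_trans (ler_sum _ (fun i _ => hS i)) _.
by rewrite sumr_const card_ord mulr_natl.
Qed.

(** * Exponential moments and tail bounds *)

(* Markov's inequality for [expR] of a sum of independent coordinates. *)
Lemma card_coord_sum_ge (R : realType) (k : nat) (d : 'I_k -> nat)
    (h : forall i, 'I_(d i) -> R) (a : R) :
  #|[set I | a <= \sum_i h i (coord I i)]|%:R
    <= expR (- a) * \prod_i \sum_j expR (h i j).
Proof.
rewrite -(sum_prod_coord (fun i j => expR (h i j))) mulr_sumr.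
rewrite -sum1_card natr_sum big_mkcond /=; apply: ler_sum => I _.
rewrite -expR_sum -expRD inE; case: ifP => [aI|_]; last exact: expR_ge0.
by rewrite -[leLHS](expR0 R) ler_expR addrC subr_ge0.
Qed.

(** Here [expR x <= 1 / (1 - x)] and [(1 + x + 2 x^2) (1 - x) = 1 + x^2 (1 - 2 x)]. Negative [x] is
    allowed, as lower tails need it. *)
Lemma expR_le_quadratic (R : realType) (x : R) :
  x <= 2^-1 -> expR x <= 1 + x + 2 * x ^+ 2.
Proof.
move=> x2; have x1 : 0 < 1 - x by lra.
rewrite -(ler_pM2r x1); apply: (@le_trans _ _ 1).
  rewrite -[leRHS](expRxMexpNx_1 x) ler_pM2l ?expR_gt0 //.
  exact: expR_ge1Dx.
have : 0 <= x ^+ 2 * (1 - 2 * x) by apply: mulr_ge0; [exact: sqr_ge0|lra].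
by rewrite -subr_ge0 => h; rewrite -subr_ge0; move: h; congr (0 <= _); ring.
Qed.

Lemma sum_expR_indicator (R : realType) (m : nat) (j0 : 'I_m) (a b : R) :
  \sum_j expR (if j == j0 then a else b) = expR a + (m%:R - 1) * expR b.
Proof.
rewrite (bigD1 j0) //= eqxx; congr (_ + _).
rewrite (eq_bigr (fun=> expR b)) => [|j /negPf->] //.
rewrite sumr_const cardC1 card_ord -[LHS]mulr_natl; congr (_ * _).
by case: m j0 => [[]//|m] _; rewrite -[m.+1%:R]natr1 addrK.
Qed.

(** The indicator of a uniform index has exponential moment at most [expR ((x + 2 x^2) / m)], and
    centering cancels [x / m]. Measured by [V * ln m], the bounds for all coordinates add up to
    [V * ln n]; for [m = 1] the centered indicator vanishes. *)
Lemma bernoulli_mgf_le (R : realType) (m : nat) (j0 : 'I_m) (x V : R) :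
  x <= 2^-1 -> m = 1%N \/ m%:R^-1 <= V * ln m%:R ->
  \sum_j expR (x * ((j == j0)%:R - m%:R^-1))
    <= m%:R * expR (2 * x ^+ 2 * V * ln m%:R).
Proof.
move=> x2 hm; have m0 : 0 < m%:R :> R by rewrite ltr0n; case: m j0 {hm} => [[]|].
rewrite (eq_bigr (fun j => expR (if j == j0 then x * (1 - m%:R^-1)
                                 else - (x * m%:R^-1)))); last first.
  by move=> j _; case: ifP => _; rewrite // sub0r mulrN.
rewrite sum_expR_indicator; case: hm => [m1|hm].
  by rewrite m1 invr1 !subrr mulr0 mul0r ln1 mulr0 expR0 addr0 mulr1.
have -> : x * (1 - m%:R^-1) = x + - (x * m%:R^-1) by ring.
rewrite expRD -mulrDl.
apply: (@le_trans _ _ (m%:R * expR ((x + 2 * x ^+ 2) / m%:R)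
                        * expR (- (x * m%:R^-1)))).
  rewrite ler_pM2r ?expR_gt0 //.
  apply: (@le_trans _ _ (m%:R * (1 + (x + 2 * x ^+ 2) / m%:R))).
    rewrite mulrDr mulr1 mulrCA divff ?lt0r_neq0 // mulr1.
    by have := expR_le_quadratic x2; lra.
  by rewrite ler_pM2l // expR_ge1Dx.
rewrite -mulrA -expRD ler_pM2l // ler_expR.
have -> : (x + 2 * x ^+ 2) / m%:R + - (x * m%:R^-1) = 2 * x ^+ 2 * m%:R^-1.
  by ring.
by rewrite -[leRHS]mulrA ler_wpM2l // mulr_ge0 ?sqr_ge0.
Qed.

(** * Decomposing one Kronecker product of elementary matrices *)

Section Stage.
Variables (R : realType) (k : nat) (dd : 'I_k -> nat).
Hypothesis dd_gt0 : forall i, (0 < dd i)%N.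
Let n := (\prod_(i < k) dd i)%N.

Lemma ln_prod_nat : ln (n%:R : R) = \sum_i ln (dd i)%:R.
Proof.
rewrite /n natr_prod.
have [] : 0 < \prod_(i < k) (dd i)%:R :> R /\
    ln (\prod_(i < k) (dd i)%:R) = \sum_i ln (dd i)%:R :> R; last by [].
apply: (big_ind2 (fun p s : R => 0 < p /\ ln p = s)).
- by rewrite ln1.
- by move=> p s p' s' [p0 <-] [p'0 <-]; rewrite mulr_gt0 // lnM.
- by move=> i _; rewrite ltr0n dd_gt0.
Qed.

(** A Chernoff bound; with [x] kept inside the sum, negative [x] handles the lower tail. *)
Lemma coord_tail (p : forall i, 'I_(dd i)) (x V a : R) :
  x <= 2^-1 ->
  (forall i, dd i = 1%N \/ (dd i)%:R^-1 <= V * ln (dd i)%:R) ->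
  #|[set I | a <= \sum_i x * ((coord I i == p i)%:R - (dd i)%:R^-1)]|%:R
    <= n%:R * expR (2 * x ^+ 2 * V * ln n%:R - a).
Proof.
move=> x2 hV.
apply: le_trans (card_coord_sum_ge
  (fun i j => x * ((j == p i)%:R - (dd i)%:R^-1)) a) _.
rewrite addrC expRD mulrCA ler_pM2l ?expR_gt0 // ln_prod_nat mulr_sumr expR_sum.
rewrite /n natr_prod -big_split /=; apply: ler_prod => i _.
rewrite bernoulli_mgf_le // andbT.
by apply: sumr_ge0 => j _; exact: expR_ge0.
Qed.

(** Here [s] is the allowed deviation, [x] the Chernoff parameter for the deleted rows and columns,
    and [y] the one for counting the entries left in a row. *)
Lemma bigtensmx_elementary_sparse (F : fieldType) (A : forall i, 'M[F]_(dd i))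
    (sp : forall i, 'S_(dd i) * 'I_(dd i)) (x y s V D : R) :
  (forall i, elementary (A i) (sp i)) ->
  0 <= x <= 2^-1 -> 0 <= y ->
  (forall i, dd i = 1%N \/ (dd i)%:R^-1 <= V * ln (dd i)%:R) ->
  (forall i, (dd i)%:R - 1 <= D * ln (dd i)%:R) ->
  sparse_plus_low_rank (expR (2 * y * s + D * expR (- y) * ln n%:R))
    (2 * n%:R * expR (2 * x ^+ 2 * V * ln n%:R - x * s)) (bigtensmx A).
Proof.
move=> elA /andP[x0 x2] y0 hV hD.
(* A row index hits the replaced row when its permuted image is [p], hence the preimage [p']. *)
pose p i := (sp i).2; pose p' i := (sp i).1^-1%g (p i).
pose wr (I : 'I_n) : R := \sum_i ((coord I i == p' i)%:R - (dd i)%:R^-1).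
pose wc (I : 'I_n) : R := \sum_i ((coord I i == p i)%:R - (dd i)%:R^-1).
pose badr := [set I : 'I_n | s < wr I].
pose badc := [set J : 'I_n | wc J < - s].
have card_badr : #|badr|%:R <= n%:R * expR (2 * x ^+ 2 * V * ln n%:R - x * s).
  apply: le_trans (coord_tail p' _ x2 hV); rewrite ler_nat subset_leq_card //.
  apply/subsetP => I; rewrite !inE => sI.
  by rewrite -mulr_sumr ler_wpM2l // ltW.
have card_badc : #|badc|%:R <= n%:R * expR (2 * x ^+ 2 * V * ln n%:R - x * s).
  have xN2 : - x <= 2^-1 by lra.
  rewrite -(sqrrN x); apply: le_trans (coord_tail p _ xN2 hV).
  rewrite ler_nat subset_leq_card //; apply/subsetP => J; rewrite !inE => sJ.
  by rewrite -mulr_sumr mulNr -mulrN ler_wpM2l // lerNr ltW.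
pose B := bigtensmx A.
pose S : 'M[F]_n :=
  \matrix_(I, J) if (I \in badr) || (J \in badc) then 0 else B I J.
exists S; split=> [I|].
  (* [h] charges [- y] for each coordinate of [J] that differs from the permuted coordinate of [I];
     Markov then bounds the number of [J] with few changes. *)
  pose h i (j : 'I_(dd i)) : R := if j == (sp i).1 (coord I i) then 0 else - y.
  have sub : row_support S I \subset
      [set J | - (2 * y * s) <= \sum_i h i (coord J i)].
    apply/subsetP => J; rewrite !inE mxE; case: ifP; rewrite ?eqxx //.
    move=> /negbT; rewrite negb_or !inE -!leNgt => /andP[sI sJ].
    rewrite /B bigtensmxE prodf_seq_neq0 => /allP nzA.
    (* A changed coordinate forces [I_t = p'_t] and [J_t <> p_t]; an unchanged one adds equally to
       both weights. The means cancel, so [wr I - wc J] is the number of changes. *)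
    have hyw : - y * (wr I - wc J) <= \sum_i h i (coord J i).
      rewrite /wr /wc -sumrB mulr_sumr; apply: ler_sum => i _.
      have /elA : A i (coord I i) (coord J i) != 0.
        by apply: nzA; rewrite mem_index_enum.
      rewrite /h opprB addrA subrK /p' /p.
      have -> : (coord I i == (sp i).1^-1%g (sp i).2) =
          ((sp i).1 (coord I i) == (sp i).2).
        by apply/eqP/eqP => [->|<-]; rewrite ?permKV ?permK.
      case: (eqVneq (coord J i) ((sp i).1 (coord I i))) => [->|neq].
        by rewrite subrr mulr0.
      case=> [/eqP|<-]; first by rewrite (negPf neq).
      by rewrite eqxx (negPf neq) subr0 mulr1.
    apply: le_trans hyw; rewrite mulNr lerN2 -mulrA mulrCA.
    by rewrite ler_wpM2l //; lra.
  apply: (@le_trans _ _ (expR (- - (2 * y * s)) * \prod_i \sum_j expR (h i j))).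
    by apply: le_trans (card_coord_sum_ge h _); rewrite ler_nat subset_leq_card.
  rewrite opprK expRD ler_pM2l ?expR_gt0 // ln_prod_nat mulr_sumr expR_sum.
  apply: ler_prod => i _; rewrite sumr_ge0 /= => [|j _]; last exact: expR_ge0.
  rewrite sum_expR_indicator expR0.
  apply: le_trans (expR_ge1Dx _) _; rewrite ler_expR mulrAC.
  by rewrite ler_pM2r ?expR_gt0.
pose S1 : 'M[F]_n := \matrix_(I, J) if I \in badr then B I J else 0.
pose S2 : 'M[F]_n :=
  \matrix_(I, J) if (I \notin badr) && (J \in badc) then B I J else 0.
have -> : B - S = S1 + S2.
  apply/matrixP => I J; rewrite !mxE.
  by case: (I \in badr); case: (J \in badc); rewrite /= ?subr0 ?addr0 ?add0r ?subrr.
rewrite -mulrA mulr_natl mulr2n; apply: le_trans (lerD card_badr card_badc).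
rewrite -natrD ler_nat; apply: leq_trans (mxrank_add _ _) _; apply: leq_add.
  by apply: mxrank_row_support => I J; rewrite mxE; case: ifP => //; rewrite eqxx.
apply: mxrank_col_support => I J; rewrite mxE.
by case: ifP => [/andP[]//|]; rewrite eqxx.
Qed.

End Stage.

(** * Combining the elementary factors *)

Lemma sparse_plus_low_rank_le (F : fieldType) (R : realType) (n : nat)
    (q r q' r' : R) (A : 'M[F]_n) : q <= q' -> r <= r' ->
  sparse_plus_low_rank q r A -> sparse_plus_low_rank q' r' A.
Proof.
move=> hq hr [S [hS rS]]; exists S; split; last exact: le_trans hr.
by move=> i; exact: le_trans hq.
Qed.

Lemma bigtensmx_sparse (F : fieldType) (R : realType) (k d : nat)
    (dd : 'I_k -> nat) (M : forall i, 'M[F]_(dd i)) (x y s V D : R) :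
  let n := (\prod_(i < k) dd i)%N in
  (forall i, 0 < dd i <= d)%N -> 0 <= x <= 2^-1 -> 0 <= y ->
  (forall i, dd i = 1%N \/ (dd i)%:R^-1 <= V * ln (dd i)%:R) ->
  (forall i, (dd i)%:R - 1 <= D * ln (dd i)%:R) ->
  sparse_plus_low_rank
    (expR ((1 + (d + d))%:R * (2 * y * s + D * expR (- y) * ln n%:R)))
    ((1 + (d + d))%:R * (2 * n%:R * expR (2 * x ^+ 2 * V * ln n%:R - x * s)))
    (bigtensmx M).
Proof.
move=> n hdd hx hy hV hD.
have [E hE] : exists E : forall i, nat -> 'M[F]_(dd i), forall i,
    (forall s, exists sp, elementary (E i s) sp) /\
    M i = \prod_(s < 1 + (d + d)) E i s.
  exists (fun i => sval (cid (elementary_product_lup (M i) (hdd i)))) => i.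
  by case: cid.
have -> : M = fun i => \prod_(s < 1 + (d + d)) E i s.
  by apply: functional_extensionality_dep => i; case: (hE i).
rewrite bigtensmx_prod expRM_natl.
apply: (@sparse_plus_low_rank_prod _ _ _ _ _ _
  (fun j => bigtensmx (fun i => E i j))) => [|j]; first exact: expR_ge0.
have elE i : exists sp, elementary (E i j) sp by case: (hE i).
apply: (@bigtensmx_elementary_sparse _ _ _ _ _ _ (fun i => sval (cid (elE i))))
  => // i.
  by case/andP: (hdd i).
by case: cid.
Qed.

Lemma rigidity_le_sqr (F : fieldType) (R : realType) (n : nat) (A : 'M[F]_n)
    (r : {nonneg R}) : (rigidity A r <= n * n)%N.
Proof.
apply: leq_trans (_ : nnz A <= _)%N.
  by apply: rigidity_le; rewrite subrr mxrank0 mulr0n ge0.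
by apply: leq_trans (max_card _) _; rewrite card_prod card_ord.
Qed.

(** The quadratic bound at [1/2] reads [expR (1/2) <= 2]. *)
Lemma ln2_ge_half (R : realType) : 2^-1 <= ln (2 : R).
Proof.
rewrite -[leLHS]expRK ler_ln ?posrE ?expR_gt0 //.
by have /expR_le_quadratic : 2^-1 <= 2^-1 :> R by []; lra.
Qed.

Lemma ln_nat_ge_half (R : realType) (d : nat) : (2 <= d)%N -> 2^-1 <= ln (d%:R : R).
Proof.
move=> d2; apply: le_trans (ln2_ge_half R) _.
by rewrite ler_ln ?posrE ?ltr0n ?ler_nat // (leq_trans _ d2).
Qed.

(** * Constants depending on [c] *)

Section Constants.
Variables (R : realType) (c : R).
Hypotheses (c_gt0 : 0 < c) (c_le1 : c <= 1).

(* [ln m / ln d] is at least this for all [m >= 2] with [c d <= m]; the value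
   follows from [ln m >= ln d + ln c] and [ln m >= 1 / 2]. *)
Definition log_ratio : R := (1 - 2 * ln c)^-1.

Lemma log_ratio_gt0 : 0 < log_ratio.
Proof. by rewrite invr_gt0; have := ln_le0 c_le1; lra. Qed.

Lemma log_ratio_le1 : log_ratio <= 1.
Proof. by rewrite invf_le1; have := ln_le0 c_le1; lra. Qed.

Lemma log_ratioP (d m : nat) : (2 <= d)%N -> (2 <= m)%N ->
  c * d%:R <= m%:R -> log_ratio * ln d%:R <= ln (m%:R : R).
Proof.
move=> d2 m2 cdm; have lc := ln_le0 c_le1.
have d0 : 0 < d%:R :> R by rewrite ltr0n (leq_trans _ d2).
have m0 : 0 < m%:R :> R by rewrite ltr0n (leq_trans _ m2).
rewrite /log_ratio mulrC ler_pdivrMr; last by lra.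
have : ln (c * d%:R) <= ln m%:R by rewrite ler_ln ?posrE // mulr_gt0.
rewrite lnM ?posrE // => ldm; have lm := ln_nat_ge_half R m2.
have : 0 <= - ln c * (ln m%:R - 2^-1) by rewrite mulr_ge0; lra.
by move=> h; nra.
Qed.

(** Bounds the ratio of the counting parameter [y], chosen later, to
    [ln d * guarded_ln (1 / eps)]. *)
Definition log_const : R := 4 + 2 * ln (12 / log_ratio).

Lemma log_const_ge4 : 4 <= log_const.
Proof.
rewrite /log_const lerDl mulr_ge0 // ln_ge0 // ler_pdivlMr ?log_ratio_gt0 //.
by have := log_ratio_le1; lra.
Qed.

(** As [rate * log_const = 1/12], the deviation uses at most half of the sparsity exponent [eps]. *)
Definition rate : R := (12 * log_const)^-1.

(** The factor [64] turns the optimized tail into [expR (- 8 * gamma * ln n)]. *)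
Definition gamma_const : R := rate ^+ 2 * c * log_ratio / 64.

Lemma rate_gt0 : 0 < rate.
Proof. by rewrite invr_gt0; have := log_const_ge4; lra. Qed.

Lemma gamma_const_gt0 : 0 < gamma_const.
Proof. by rewrite !mulr_gt0 ?exprn_gt0 ?rate_gt0 ?log_ratio_gt0. Qed.

End Constants.

(** * Choice of parameters and the rigidity bound *)

Lemma powR_expR (R : realType) (a x : R) : 0 < a -> a `^ x = expR (x * ln a).
Proof. by move=> a0; rewrite /powR gt_eqF. Qed.

Lemma rigidity_bigtensmx_lt1 (R : realType) (c : R) (d : nat) (eps : R)
    (F : fieldType) (k : nat) (dd : 'I_k -> nat)
    (M : forall i : 'I_k, 'M[F]_(dd i)) :
  0 < c -> c <= 1 -> (2 <= d)%N -> 0 < eps -> eps < 1 ->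
  (forall i : 'I_k, c * d%:R <= (dd i)%:R /\ (dd i <= d)%N) ->
  let gamma := gamma_const c * (1 / (d%:R * ln d%:R)
                 * (eps ^+ 2 / guarded_ln (1 / eps) ^+ 2)) in
  let n := (\prod_(i < k) dd i)%N in
  d%:R `^ (1 / gamma) <= n%:R ->
  (rigidity (bigtensmx M) (n%:R `^ (1 - gamma))%:nng)%:R
    <= n%:R `^ (1 + eps).
Proof.
move=> c0 c1 d2 e0 e1 hdd gamma n hn.
have d0 : 0 < d%:R :> R by rewrite ltr0n (leq_trans _ d2).
have dr2 : 2 <= d%:R :> R by rewrite ler_nat.
have dd0 i : (0 < dd i)%N.
  by rewrite -(ltr0n R); apply: lt_le_trans (hdd i).1; rewrite mulr_gt0.
have n0 : 0 < n%:R :> R by rewrite ltr0n prodn_gt0.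
have ld := ln_nat_ge_half R d2; have ld0 : 0 < ln (d%:R : R) by lra.
have := log_ratio_gt0 c1; have := log_ratio_le1 c1.
have := log_const_ge4 c1; have := rate_gt0 c1; have := gamma_const_gt0 c0 c1.
have := log_ratioP c0 c1 d2.
set b := log_ratio c; set C := log_const c; set a := rate c.
set K := gamma_const c => hb K0 a0 C4 b1 b0.
pose G := guarded_ln (1 / eps); pose l := ln (d%:R : R).
have gammaE : gamma = K * (1 / (d%:R * l) * (eps ^+ 2 / G ^+ 2)) by [].
rewrite -/l in hb ld ld0; move: gamma gammaE hn => gamma gammaE hn.
have G1 : 1 <= G by rewrite /G /guarded_ln le_max lexx.
have lneG : ln eps^-1 <= G by rewrite /G /guarded_ln div1r le_max lexx orbT.
have G0 : 0 < G by lra.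
have gamma0 : 0 < gamma.
  by rewrite gammaE mulr_gt0 // mulr_gt0 // divr_gt0 ?mulr_gt0 ?exprn_gt0.
pose L := ln (n%:R : R).
have gammaL : l <= gamma * L.
  have : ln (d%:R `^ (1 / gamma)) <= L.
    by rewrite ler_ln ?posrE ?powR_gt0.
  by rewrite ln_powR -/l div1r mulrC ler_pdivrMr // [L * _]mulrC.
have L0 : 0 < L by rewrite -(pmulr_rgt0 _ gamma0); lra.
(* Chosen so that [V * (b * l) = 1 / (c d)] and [D * (b * l) = d]. *)
pose V : R := (c * b * d%:R * l)^-1; pose D : R := d%:R / (b * l).
have V0 : 0 < V by rewrite invr_gt0 !mulr_gt0.
have D0 : 0 < D by rewrite divr_gt0 ?mulr_gt0.
have small i : dd i = 1%N \/ b * l <= ln (dd i)%:R.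
  have [lt2|ge2] := ltnP (dd i) 2; last by right; apply: hb => //; case: (hdd i).
  by left; apply/eqP; rewrite eqn_leq -ltnS lt2 dd0.
have hV i : dd i = 1%N \/ (dd i)%:R^-1 <= V * ln (dd i)%:R.
  case: (small i) => [|bl]; [by left|right].
  apply: (@le_trans _ _ (V * (b * l))); last by rewrite ler_pM2l.
  have -> : V * (b * l) = (c * d%:R)^-1.
    by rewrite /V; field; rewrite ?lt0r_neq0.
  rewrite lef_pV2 ?posrE ?ltr0n ?mulr_gt0 //.
  by case: (hdd i).
have hD i : (dd i)%:R - 1 <= D * ln (dd i)%:R.
  case: (small i) => [->|bl]; first by rewrite subrr ln1 mulr0.
  apply: (@le_trans _ _ (D * (b * l))); last by rewrite ler_pM2l.
  have -> : D * (b * l) = d%:R by rewrite /D divfK // mulf_neq0 ?lt0r_neq0.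
  have : (dd i)%:R <= d%:R :> R by rewrite ler_nat; case: (hdd i).
  by lra.
(* Makes [3 d * D * expR (- y)] equal to [eps / (4 l)], which is at most [eps / 2]. *)
pose y := ln (12 * d%:R ^+ 2 / (eps * b)).
have yarg0 : 0 < 12 * d%:R ^+ 2 / (eps * b).
  by rewrite divr_gt0 ?mulr_gt0 ?exprn_gt0.
have y0 : 0 <= y.
  apply: ln_ge0; rewrite ler_pdivlMr ?mulr_gt0 // mul1r.
  by apply: (@le_trans _ _ 1); [apply: mulr_ile1|]; nra.
have expRNy : expR (- y) = eps * b / (12 * d%:R ^+ 2).
  by rewrite expRN lnK ?posrE // invf_div.
have yC : y <= C * (l * G).
  have -> : y = ln eps^-1 + 2 * l + ln (12 / b).
    have -> : y = ln (eps^-1 * d%:R ^+ 2 * (12 / b)).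
      by congr ln; field; rewrite ?lt0r_neq0.
    have pe : eps^-1 \is Num.pos by rewrite posrE invr_gt0.
    have pd : d%:R ^+ 2 \is @Num.pos R by rewrite posrE exprn_gt0.
    have pb : 12 / b \is Num.pos by rewrite posrE divr_gt0.
    rewrite (lnM _ pb) ?(lnM pe pd) ?lnXn ?mulr_natl //.
    by rewrite posrE mulr_gt0 // -posrE.
  have lb0 : 0 <= ln (12 / b).
    by apply: ln_ge0; rewrite ler_pdivlMr // mul1r; lra.
  have -> : C = 4 + 2 * ln (12 / b) by [].
  (* [l >= 1/2] and [G >= 1] let each summand of [y] be charged to [l * G]. *)
  have lG : 1 <= 2 * (l * G) by nra.
  have lG' : l <= l * G by nra.
  have lG'' : G <= 2 * (l * G) by nra.
  have : ln (12 / b) <= ln (12 / b) * (2 * (l * G)) by rewrite ler_peMr.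
  by lra.
(* The deviation will be [s = eta * L]. *)
pose eta := a * eps / (d%:R * l * G).
have eta0 : 0 < eta by rewrite divr_gt0 ?mulr_gt0.
(* The minimizer of [2 x^2 V L - x * eta * L]. *)
pose x := eta / (4 * V).
have aC : a * C = 12^-1.
  by rewrite /a /rate -/C; field; rewrite lt0r_neq0 //; lra.
have a1 : a <= 1 by nra.
have hx : 0 <= x <= 2^-1.
  apply/andP; split; first by rewrite ltW // divr_gt0 // mulr_gt0.
  have -> : x = a * eps * (c * b) / (4 * G).
    by rewrite /x /eta /V; field; rewrite ?lt0r_neq0.
  rewrite ler_pdivrMr ?mulr_gt0 //.
  have h1 : a * eps <= 1 by apply: mulr_ile1; lra.
  have h2 : c * b <= 1 by apply: mulr_ile1; lra.
  have : a * eps * (c * b) <= 1 by apply: mulr_ile1; rewrite ?mulr_ge0 //; lra.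
  by lra.
have dd_le i : (0 < dd i <= d)%N by rewrite dd0; case: (hdd i).
have m_le : (1 + (d + d))%:R <= 3 * d%:R :> R by rewrite !natrD; lra.
have m_ge0 : 0 <= (1 + (d + d))%:R :> R by [].
have := bigtensmx_sparse M (eta * L) dd_le hx y0 hV hD.
rewrite -/n -/L; set q := expR _; set r := _%:R * _ => hM.
have hq : n%:R * q <= n%:R `^ (1 + eps).
  rewrite powR_expR // -/L -{1}(lnK n0) -/L /q -expRD ler_expR.
  have -> : (1 + eps) * L = L + eps * L by ring.
  rewrite lerD2l.
  apply: (@le_trans _ _ (3 * d%:R * (2 * y * (eta * L) + D * expR (- y) * L))).
    apply: ler_wpM2r => //.
    apply: addr_ge0.
      by apply: mulr_ge0 (mulr_ge0 _ y0) (mulr_ge0 (ltW eta0) (ltW L0)).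
    exact: mulr_ge0 (mulr_ge0 (ltW D0) (expR_ge0 _)) (ltW L0).
  have -> : 3 * d%:R * (2 * y * (eta * L) + D * expR (- y) * L) =
      (6 * a * (y / (l * G)) + 1 / (4 * l)) * (eps * L).
    by rewrite expRNy /D /eta; field; rewrite ?lt0r_neq0.
  rewrite -[leRHS]mul1r ler_pM2r ?mulr_gt0 //.
  have h1 : y / (l * G) <= C by rewrite ler_pdivrMr ?mulr_gt0.
  have h2 : a * (y / (l * G)) <= 12^-1 by rewrite -aC ler_pM2l.
  have h3 : 1 / (4 * l) <= 2^-1 by rewrite ler_pdivrMr; lra.
  by lra.
have hr : r <= n%:R `^ (1 - gamma).
  have -> : r = (1 + (d + d))%:R * 2 * expR (L - 8 * (gamma * L)).
    rewrite /r expRD -{1}(lnK n0) -/L.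
    have -> : 2 * x ^+ 2 * V * L - x * (eta * L) = - (8 * (gamma * L)).
      rewrite /x gammaE /K /gamma_const -/a -/b /eta /V.
      by field; rewrite ?lt0r_neq0.
    by ring.
  (* The prefactor is at most [d^4], costing [4 l <= 4 * gamma * L] of the gain [8 * gamma * L]. *)
  have h6 : (1 + (d + d))%:R * 2 <= expR (4 * l).
    rewrite expRM_natl lnK ?posrE //.
    have : 8 <= d%:R ^+ 3 :> R.
      have -> : 8 = 2 ^+ 3 :> R by ring.
      by rewrite lerXn2r ?nnegrE //; lra.
    by rewrite (exprS _ 3); nra.
  apply: le_trans (ler_wpM2r (expR_ge0 _) h6) _.
  by rewrite powR_expR // -/L -expRD ler_expR; lra.
apply: le_trans hq; apply: sparse_plus_low_rank_rigidity.
exact: sparse_plus_low_rank_le hM.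
Qed.

Unset Implicit Arguments.

Theorem theorem1p4 (R : realType) (c : R) (hc : 0 < c) :
  exists2 K : R, 0 < K &
    forall (d : nat) (eps : R), (2 <= d)%N -> 0 < eps ->
    exists gamma : R,
      [/\ 0 < gamma,
          K * (1 / (d%:R * ln d%:R)
               * (eps ^+ 2 / guarded_ln (1 / eps) ^+ 2)) <= gamma &
          forall (F : fieldType) (k : nat) (dd : 'I_k -> nat)
                 (M : forall i : 'I_k, 'M[F]_(dd i)),
            (forall i : 'I_k, c * d%:R <= (dd i)%:R /\ (dd i <= d)%N) ->
            let n := (\prod_(i < k) dd i)%N in
            d%:R `^ (1 / gamma) <= n%:R ->
            (rigidity (bigtensmx M) (n%:R `^ (1 - gamma))%:nng)%:R
              <= n%:R `^ (1 + eps)].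
Proof.
(* The constants require [ln c <= 0]; lowering [c] to [c1] only weakens the size condition. *)
pose c1 := Num.min c 1.
have c1_gt0 : 0 < c1 by rewrite lt_min hc ltr01.
have c1_le1 : c1 <= 1 by rewrite ge_min lexx orbT.
exists (gamma_const c1); first exact: gamma_const_gt0.
move=> d eps d2 e0.
exists (gamma_const c1 * (1 / (d%:R * ln d%:R)
               * (eps ^+ 2 / guarded_ln (1 / eps) ^+ 2))).
have ld := ln_nat_ge_half R d2.
have d0 : 0 < d%:R :> R by rewrite ltr0n (leq_trans _ d2).
have G0 : 0 < guarded_ln (1 / eps) by rewrite lt_max ltr01.
split=> //.
  rewrite mulr_gt0 ?gamma_const_gt0 // mulr_gt0 ?divr_gt0 ?mulr_gt0 ?exprn_gt0 //.
  by lra.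
move=> F k dd M hdd n hn.
have [e1|e1] := ltP eps 1.
  apply: (rigidity_bigtensmx_lt1 M c1_gt0 c1_le1 d2 e0 e1) hn => i.
  case: (hdd i) => ci di; split=> //; apply: le_trans ci.
  by rewrite ler_pM2r // ge_min lexx.
(* For [eps >= 1] the trivial bound [n^2] suffices. *)
have n1 : 1 <= n%:R :> R.
  rewrite ler1n prodn_gt0 // => i; rewrite -(ltr0n R).
  by apply: lt_le_trans (hdd i).1; rewrite mulr_gt0.
apply: (@le_trans _ _ (n * n)%:R); first by rewrite ler_nat rigidity_le_sqr.
rewrite natrM -expr2 -powR_mulrn //; apply: ler_powR => //; lra.
Qed.
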